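(* Let $p$ be a strongly admissible premonic pattern and let $\Lambda$ be a numerical semigroup admitting $p$. Then $\Lambda$ has a unique minimal $p$-system of generators.
   Context: $\mathbb{N}$ denotes the set of nonnegative integers. A numerical semigroup is a subset of $\mathbb{N}$ that contains $0$, is closed under addition and has finite complement in $\mathbb{N}$. A pattern of length $n$ is a linear homogeneous polynomial $p=\sum_{i=1}^n a_ix_i$ with all $a_i$ non-zero integers (for $n=0$ the unique pattern is $p=0$). A numerical semigroup $\Lambda$ admits $p$ if $p(s_1,\dots,s_n)\in\Lambda$ for all $s_1\geq s_2\geq\dots\geq s_n$ in $\Lambda$; $\mathcal{S}(p)$ is the set of all numerical semigroups admitting $p$. The pattern $p$ is admissible if $\mathcal{S}(p)\neq\emptyset$, equivalently if $\sum_{i=1}^{n'}a_i\ge 0$ for all $1\le n'\le n$. Set $p'=p-x_1$ if $a_1>1$ and $p'=p(0,x_1,x_2,\dots,x_{n-1})$ otherwise. The pattern $p$ is strongly admissible if both $p$ and $p'$ are admissible. The pattern $p$ is premonic if $\sum_{i=1}^{n'}a_i=1$ for some $1\le n'\leq n$. For an admissible pattern $p$, the $p$-closure of a numerical semigroup $\Lambda$ is the intersection of all $\Gamma\in\mathcal{S}(p)$ with $\Lambda\subseteq\Gamma$. For $A\subseteq\mathbb{N}$, $\langle A\rangle$ is the submonoid of $(\mathbb{N},+)$ generated by $A$. For $\Lambda\in\mathcal{S}(p)$, a set $A\subseteq\mathbb{N}$ is a $p$-system of generators of $\Lambda$ if $\langle A\rangle$ is a numerical semigroup whose $p$-closure is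 equal to $\Lambda$. It is minimal if it is minimal with respect to set inclusion among the $p$-systems of generators of $\Lambda$. *)

(* Defs.v *)
From mathcomp Require Import all_boot all_order all_algebra.
From mathcomp Require Import boolp classical_sets cardinality.

Set Implicit Arguments.
Unset Strict Implicit.
Unset Printing Implicit Defensive.

Import GRing.Theory.
Local Open Scope classical_set_scope.
Local Open Scope ring_scope.

Definition is_submonoid (M : set nat) : Prop :=
  M 0%N /\ (forall x y, M x -> M y -> M (x + y)%N).

Definition numerical_semigroup (L : set nat) : Prop :=
  is_submonoid L /\ finite_set (~` L).

Definition submonoid_gen (A : set nat) : set nat := smallest is_submonoid A.

(* The linear form a_1 x_1 + ... + a_n x_n is encoded by its coefficient
   sequence [:: a_1; ...; a_n], so that n = size p. *)
Definition is_pattern (p : seq int) : Prop := 0 \notin p.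

Definition pattern_eval (p : seq int) (s : seq nat) : int :=
  \sum_(i < size p) p`_i * (nth 0%N s i)%:Z.

(* The value of a pattern is an integer, possibly negative; it must be the
   image of an element of L under the embedding of nat into int. *)
Definition admits (L : set nat) (p : seq int) : Prop :=
  forall s : seq nat, size s = size p -> sorted geq s ->
    (forall x, x \in s -> L x) ->
    [set m%:Z | m in L] (pattern_eval p s).

Definition admitting (p : seq int) : set (set nat) :=
  [set L | numerical_semigroup L /\ admits L p].

Definition admissible (p : seq int) : Prop := admitting p !=set0.

(* p' is p - x_1 if a_1 > 1 and p(0, x_1, ..., x_(n-1)) otherwise: setting the
   first variable to 0 and shifting the others drops the first coefficient. *)
Definition derived_pattern (p : seq int) : seq int :=
  match p with
  | [::] => [::]
  | a :: q => if 1 < a then (a - 1) :: q else q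
  end.

Definition strongly_admissible (p : seq int) : Prop :=
  admissible p /\ admissible (derived_pattern p).

Definition premonic (p : seq int) : Prop :=
  exists2 m : nat, (1 <= m <= size p)%N & \sum_(i < m) p`_i = 1.

(* [smallest C G] is the intersection of all sets in C containing G; it need
   not belong to C a priori. *)
Definition pattern_closure (p : seq int) (L : set nat) : set nat :=
  smallest (admitting p) L.

Definition system_of_generators (p : seq int) (L A : set nat) : Prop :=
  numerical_semigroup (submonoid_gen A) /\
  pattern_closure p (submonoid_gen A) = L.

Definition minimal_system_of_generators (p : seq int) (L A : set nat) : Prop :=
  system_of_generators p L A /\
  (forall B, system_of_generators p L B -> B `<=` A -> B = A).

(* Main.v *)
(* The scaling k * s of an arbitrary sequence lies in any given numerical
   semigroup for a suitable k > 0, so an admissible pattern is nonnegative on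
   every nonincreasing sequence of naturals.  Applied to p', this shows that
   p(s_1, ..., s_n) >= s_1 when p is strongly admissible: sums and values of p
   either belong to their arguments or exceed all of them.  Hence the elements
   s of L for which L \ {s} is still a semigroup admitting p belong to every
   p-system of generators of L, and by strong induction any submonoid admitting
   p that contains them contains L.  They have gcd 1, since the multiples of d
   form such a submonoid; so they are themselves a p-system of generators, the
   least one. *)
Require Import Defs.
From mathcomp Require Import all_boot all_order all_algebra.
From mathcomp Require Import boolp classical_sets cardinality.
From mathcomp Require Import zify.

Set Implicit Arguments.
Unset Strict Implicit.
Unset Printing Implicit Defensive.

Import Order.TTheory GRing.Theory Num.Theory.
Local Open Scope classical_set_scope.
Local Open Scope ring_scope.

Lemma submonoid_muln (M : set nat) (k x : nat) :
  is_submonoid M -> M x -> M (k * x)%N.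
Proof.
by move=> [M0 MD] Mx; elim: k => [|k IHk] //; rewrite mulSn; apply: MD.
Qed.

Lemma submonoid_gen_sub (A M : set nat) :
  is_submonoid M -> A `<=` M -> submonoid_gen A `<=` M.
Proof. by move=> hM AM; apply: smallest_sub. Qed.

Lemma submonoid_gen_submonoid (A : set nat) : is_submonoid (submonoid_gen A).
Proof.
split=> [M [[]] //|x y Ax Ay M [hM AM]].
by case: (hM) => _; apply; [apply: Ax | apply: Ay].
Qed.

Lemma cofinite_natP (M : set nat) :
  finite_set (~` M) <-> exists N, forall n, (N <= n)%N -> M n.
Proof.
split=> [/finite_seqP[s hs]|[N hN]].
  exists (\max_(i <- s) i).+1 => n hn; apply: contrapT => nM.
  have: n \in s by have : (~` M) n by []; rewrite hs.
  move=> /(@leq_bigmax_seq _ s predT id n) /(_ isT) /=.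
  by move=> /(leq_trans hn); rewrite ltnn.
apply: (sub_finite_set _ (finite_II N)) => n /= nM.
by rewrite ltnNge; apply/negP => /hN.
Qed.

(* The least positive difference of two elements of M divides every element
   of M, hence is 1; and two consecutive elements generate a cofinite set. *)
Lemma submonoid_cofinite (M : set nat) :
  is_submonoid M ->
  (forall d : nat, (0 < d)%N -> M `<=` [set m | d %| m]%N -> d = 1%N) ->
  finite_set (~` M).
Proof.
move=> hM hgcd; have [M0 MD] := hM.
pose D d := `[< (0 < d)%N /\ exists x, M x /\ M (x + d)%N >].
have exD : exists d, D d.
  apply: contrapT => nD.
  (* Without positive differences [M] is {0}, and [hgcd] at 2 would give 2 = 1. *)
  suff /(hgcd 2 isT) : M `<=` [set m | 2 %| m]%N by [].
  move=> m Mm /=; case: m Mm => // m Mm; case: nD.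
  by exists m.+1; apply/asboolP; split=> //; exists 0%N.
have [d /asboolP[d_gt0 [x [Mx Mxd]]] dmin] := ex_minnP exD.
have d1 : d = 1%N.
  apply: hgcd => // m Mm /=; rewrite /dvdn; apply/negPn/negP => r_neq0.
  have : D (m %% d)%N.
    apply/asboolP; split; first by rewrite lt0n.
    (* Adding [m %% d] to this witness gives [m %/ d * x + m], again in [M]. *)
    exists (m %/ d * (x + d))%N; split; first exact: submonoid_muln.
    rewrite mulnDr -addnA -divn_eq.
    by apply: MD => //; apply: submonoid_muln.
  by move=> /dmin; rewrite leqNgt ltn_pmod.
rewrite {}d1 addn1 in Mxd; apply/cofinite_natP.
have [x0|x_gt0] := posnP x.
  exists 0%N => n _; rewrite -[n]muln1; apply: submonoid_muln => //.
  by rewrite x0 in Mxd.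
(* From [x * x] on, the quotient of [n] by [x] exceeds the remainder, so the coefficient of [x]
   below is a true difference. *)
exists (x * x)%N => n hn.
have r_lt : (n %% x < x)%N by rewrite ltn_pmod.
have q_ge : (x <= n %/ x)%N by rewrite leq_divRL.
have -> : n = (n %% x * x.+1 + (n %/ x - n %% x) * x)%N.
  rewrite {1}(divn_eq n x) mulnS mulnBl.
  have : (n %% x * x <= n %/ x * x)%N by rewrite leq_mul2r; lia.
  lia.
by apply: MD; apply: submonoid_muln.
Qed.

Lemma pattern_eval_map_muln (p : seq int) (k : nat) (s : seq nat) :
  size s = size p ->
  pattern_eval p (map (muln k) s) = k%:Z * pattern_eval p s.
Proof.
move=> ss; rewrite /pattern_eval mulr_sumr; apply: eq_bigr => i _.
by rewrite (nth_map 0%N) ?ss // PoszM mulrCA.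
Qed.

Lemma pattern_eval_cons (a : int) (q : seq int) (x : nat) (s : seq nat) :
  pattern_eval (a :: q) (x :: s) = a * x%:Z + pattern_eval q s.
Proof. by rewrite /pattern_eval big_ord_recl. Qed.

Lemma sorted_geq_map_muln (k : nat) (s : seq nat) :
  sorted geq s -> sorted geq (map (muln k) s).
Proof.
by apply: homo_sorted => x y /= yx; rewrite leq_mul2l yx orbT.
Qed.

Lemma admissible_eval_ge0 (p : seq int) (s : seq nat) :
  admissible p -> size s = size p -> sorted geq s -> 0 <= pattern_eval p s.
Proof.
move=> [G [[[G0 GD] /cofinite_natP[N hN]] Gp]] ss sos.
(* Scaling by [N.+1] fixes 0 and pushes every positive entry past [N], hence into [G]. *)
have [||x /mapP[t _ ->]|m _ em] := Gp (map (muln N.+1) s).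
- by rewrite size_map.
- exact: sorted_geq_map_muln.
- by case: t => [|t]; [rewrite muln0|apply: hN; rewrite mulnS; lia].
have : 0 <= N.+1%:Z * pattern_eval p s by rewrite -pattern_eval_map_muln // -em.
by rewrite pmulr_rge0.
Qed.

(** In both cases of the definition of p', p(s) is the largest entry of [s] plus a value of p', at
    [s] or at its tail. *)
Lemma strongly_admissible_eval_ge (p : seq int) (s : seq nat) (x : nat) :
  is_pattern p -> strongly_admissible p -> size s = size p -> sorted geq s ->
  x \in s -> x%:Z <= pattern_eval p s.
Proof.
case: p => [|a q] hp [hp1 hp2]; first by case: s.
case: s => [//|y s] [ss] sos xs.
have xy : (x <= y)%N.
  move: xs; rewrite inE => /orP[/eqP-> //|].
  have /allP : all (geq y) s.
    by apply: order_path_min sos => u v w /= vu wv; apply: leq_trans wv _.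
  exact.
have a_ge0 : 0 <= a.
  (* The value at (1, 0, ..., 0) is [a]. *)
  have := @admissible_eval_ge0 (a :: q) (1%N :: nseq (size q) 0%N) hp1.
  rewrite /= size_nseq => /(_ erefl); rewrite pattern_eval_cons.
  rewrite [pattern_eval _ _]big1 => [|i _]; last by rewrite nth_nseq if_same mulr0.
  rewrite mulr1 addr0; apply.
  by case: (size q) => // n /=; elim: n.
have a_neq0 : a != 0 by move: hp; rewrite /is_pattern inE negb_or eq_sym => /andP[].
apply: (@le_trans _ _ y%:Z) => //; rewrite pattern_eval_cons.
move: hp2; rewrite /=; case: ifP => [a_gt1|a_le1] hp2.
  have := @admissible_eval_ge0 _ (y :: s) hp2.
  rewrite /= ss pattern_eval_cons => /(_ erefl sos).
  by rewrite mulrBl mul1r addrAC subr_ge0.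
have -> : a = 1 by lia.
by rewrite mul1r lerDl; apply: admissible_eval_ge0 => //; apply: path_sorted sos.
Qed.

Lemma multiples_submonoid (d : nat) : is_submonoid [set m | d %| m]%N.
Proof. by split=> [|x y] /=; [exact: dvdn0|exact: dvdn_add]. Qed.

Lemma multiples_admits (p : seq int) (d : nat) :
  (0 < d)%N -> admissible p -> admits [set m | d %| m]%N p.
Proof.
move=> d_gt0 hp s ss sos sd.
pose t := map (divn^~ d) s.
have st : s = map (muln d) t.
  rewrite -map_comp -[LHS]map_id; apply/eq_in_map => x /sd /= dx.
  by rewrite mulnC divnK.
have sz_t : size t = size p by rewrite size_map.
have sot : sorted geq t.
  by apply: homo_sorted sos => x y /= yx; apply: leq_div2r.
exists (d * `|pattern_eval p t|)%N; first exact: dvdn_mulr.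
rewrite st pattern_eval_map_muln // PoszM abszE ger0_norm //.
exact: admissible_eval_ge0.
Qed.

(** For the zero pattern these are the usual minimal generators of [L]. *)
Definition p_irreducibles (p : seq int) (L : set nat) : set nat :=
  [set s | L s /\ admitting p (L `\ s)].

Lemma p_irreducibles_sub (p : seq int) (L A : set nat) :
  system_of_generators p L A -> p_irreducibles p L `<=` A.
Proof.
move=> [_ clA] s [Ls hLs]; apply: contrapT => nAs.
have AL : A `<=` L.
  by rewrite -clA => x Ax G [_ AG]; apply: AG => M [_]; apply.
suff /(_ s) : L `<=` L `\ s by case=> // _; apply.
rewrite -{1}clA; apply: smallest_sub => //.
apply: submonoid_gen_sub; first by case: hLs => [[]].
by move=> x Ax; split=> [|xs]; [exact: AL|apply: nAs; rewrite -xs].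
Qed.

(** [G] need not be cofinite, so that the multiples of [d] qualify. A least [s] of [L] outside [G]
    cannot arise from other elements of [L]: these would be smaller, hence in [G]. *)
Lemma sub_of_p_irreducibles (p : seq int) (L G : set nat) :
  is_pattern p -> strongly_admissible p -> admitting p L ->
  is_submonoid G -> admits G p -> p_irreducibles p L `<=` G -> L `<=` G.
Proof.
move=> hp hsa [[[L0 LD] Lfin] Lp] [G0 GD] Gp IG s.
elim/ltn_ind: s => s IHs Ls; apply: contrapT => nGs; apply: (nGs).
apply: IG; split=> //; split; [split; [split|]|].
- by split=> // s0; apply: nGs; rewrite -s0.
- move=> x y [Lx /= nxs] [Ly /= nys]; split; first exact: LD.
  move=> xys; apply: nGs; rewrite -xys.
  by apply: GD; apply: IHs => //; lia.
- have [N hN] := (cofinite_natP L).1 Lfin.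
  apply/cofinite_natP; exists (maxn N s.+1) => n.
  by rewrite geq_max => /andP[Nn sn]; split; [exact: hN|move=> /=; lia].
- move=> t st sot Lt; have [|m Lm em] := Lp t st sot; first by move=> x /Lt[].
  exists m => //; split=> //= ms; apply: nGs.
  have [|k Gk ek] := Gp t st sot.
    move=> x xt; have [Lx /= nxs] := Lt x xt; apply: IHs => //.
    have := strongly_admissible_eval_ge hp hsa st sot xt.
    by rewrite -em ms; lia.
  by have <- : k = s by move: ek; rewrite -em ms => -[].
Qed.

Lemma p_irreducibles_generate (p : seq int) (L : set nat) :
  is_pattern p -> strongly_admissible p -> admitting p L ->
  system_of_generators p L (p_irreducibles p L).
Proof.
move=> hp hsa hL; have subL := sub_of_p_irreducibles hp hsa hL.
have subgen : p_irreducibles p L `<=` submonoid_gen (p_irreducibles p L).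
  exact: sub_gen_smallest.
split.
  split; first exact: submonoid_gen_submonoid.
  apply: submonoid_cofinite; first exact: submonoid_gen_submonoid.
  move=> d d_gt0 hd.
  (* This forces [d] to divide two consecutive integers. *)
  have Ld : L `<=` [set m | d %| m]%N.
    apply: subL; [exact: multiples_submonoid| |exact: subset_trans hd].
    by apply: multiples_admits => //; case: hsa.
  have [[_ /cofinite_natP[N hN]] _] := hL.
  have dN : (d %| N)%N by apply: Ld; apply: hN.
  have : (d %| N.+1)%N by apply: Ld; apply: hN.
  by rewrite -addn1 dvdn_addr // dvdn1 => /eqP.
apply/seteqP; split.
  apply: smallest_sub => //; apply: submonoid_gen_sub; first by case: hL => [[]].
  by move=> x [].
move=> x Lx G [[[hG _] Gp] AG]; apply: subL Lx => //.
exact: subset_trans AG.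
Qed.

Theorem theorem28 (p : seq int) (L : set nat)
  (hp : is_pattern p) (hsa : strongly_admissible p) (hpm : premonic p)
  (hL : admitting p L) :
  exists! A : set nat, minimal_system_of_generators p L A.
Proof.
have hI := p_irreducibles_generate hp hsa hL.
exists (p_irreducibles p L); split=> [|A [hA minA]].
  split=> // B hB BI; apply/seteqP; split=> //.
  exact: p_irreducibles_sub.
(* The irreducibles lie in [A] and already generate, so minimality of [A] forces equality. *)
by apply: minA => //; apply: p_irreducibles_sub.
Qed.
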